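(* Let $(X,\rho)$ be a metric space, let $A$ and $B$ be subsets of $X$, let $(A,\rho)$ be complete, and let the ordered pair $(A,B)$ satisfy the property $UC$. Then the ordered pair $(A,B)$ satisfies the property $CD$.
   Context: $\mathrm{dist}(A,B)=\inf_{a\in A,b\in B}\rho(a,b)$. Property $UC$: the ordered pair $(A,B)$ of subsets of a metric space $(X,\rho)$ satisfies the property $UC$ if for all sequences $\{x_n\}_{n=0}^\infty\subseteq A$, $\{z_n\}_{n=0}^\infty\subseteq A$, $\{y_n\}_{n=0}^\infty\subseteq B$ with $\lim_{n\to\infty}\rho(x_n,y_n)=\mathrm{dist}(A,B)$ and $\lim_{n\to\infty}\rho(z_n,y_n)=\mathrm{dist}(A,B)$, one has $\lim_{n\to\infty}\rho(x_n,z_n)=0$. Property $CD$ (Convergent by Distance): the ordered pair $(A,B)$ satisfies the property $CD$ if for every pair of sequences $\{x_n\}_{n=1}^\infty\subseteq A$, $\{y_n\}_{n=1}^\infty\subseteq B$ with $\lim_{k\to\infty}\sup_{n\ge k,\,m\ge k}\rho(x_n,y_m)=\mathrm{dist}(A,B)$, the sequence $\{x_n\}_{n=1}^\infty$ converges in $A$ (to a point of $A$). *)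

(* Defs.v *)
From HB Require Import structures.
From mathcomp Require Import all_boot all_order all_algebra.
From mathcomp Require Import all_classical all_reals all_analysis.

Set Implicit Arguments.
Unset Strict Implicit.
Unset Printing Implicit Defensive.

Import Order.TTheory GRing.Theory Num.Theory.
Import numFieldNormedType.Exports.

Local Open Scope classical_set_scope.
Local Open Scope ring_scope.
Local Open Scope ereal_scope.

(* Extended-real valued, so that the distance is [+oo] when [A] or [B] is
   empty; otherwise it is a nonnegative real number. *)
Definition set_dist (R : realType) (X : metricType R) (A B : set X) : \bar R :=
  ereal_inf [set (mdist a b)%:E | a in A & b in B].

(* Completeness of [A] for the restricted metric: a sequence in [A] is Cauchy
   in [A] iff it is Cauchy in [X], and its limit is required to lie in [A]. *)
Definition complete_set (R : realType) (X : metricType R) (A : set X) : Prop :=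
  forall u : nat -> X, (forall n, A (u n)) -> cauchy (u @ \oo) ->
    exists2 l, A l & u @ \oo --> l.

Definition property_UC (R : realType) (X : metricType R) (A B : set X) : Prop :=
  forall x z y : nat -> X,
    (forall n, A (x n)) -> (forall n, A (z n)) -> (forall n, B (y n)) ->
    (mdist (x n) (y n))%:E @[n --> \oo] --> set_dist A B ->
    (mdist (z n) (y n))%:E @[n --> \oo] --> set_dist A B ->
    mdist (x n) (z n) @[n --> \oo] --> (0 : R)%R.

(* The supremum is taken in [\bar R]: it is [+oo] on an unbounded tail, whereas
   the real-valued [sup] would return the default value [0] there. *)
Definition property_CD (R : realType) (X : metricType R) (A B : set X) : Prop :=
  forall x y : nat -> X,
    (forall n, A (x n)) -> (forall n, B (y n)) ->
    ereal_sup [set (mdist (x n) (y m))%:E |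
                n in [set n | (k <= n)%N] & m in [set m | (k <= m)%N]]
      @[k --> \oo] --> set_dist A B ->
    exists2 l, A l & x @ \oo --> l.

(* Main.v *)
Require Import Defs.
From HB Require Import structures.
From mathcomp Require Import all_boot all_order all_algebra.
From mathcomp Require Import all_classical all_reals all_analysis.

(** By completeness it suffices that [x] is Cauchy whenever the tail suprema of
    the distances [mdist (x n) (y m)] tend to [set_dist A B].  If it is not,
    some [p k >= k] keeps [x (p k)] at a fixed distance from [x k]
    ([cauchy_tail_selection]).  But [x k] and [x (p k)] can both be compared
    with the same point [y k]: their distances to it lie between [set_dist A B]
    and the supremum over the [k]-th tails, hence tend to [set_dist A B]
    ([cvg_mdist_tail_selection]).  Property [UC] then forces [x k] and [x (p k)]
    to merge, a contradiction. *)

Set Implicit Arguments.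
Unset Strict Implicit.
Unset Printing Implicit Defensive.

Import Order.TTheory GRing.Theory Num.Theory.
Import numFieldNormedType.Exports.

Local Open Scope classical_set_scope.
Local Open Scope ring_scope.

(** If [u] is not Cauchy, no tail of [u] stays close to its own first term; the
    offending indices, one for each tail, form a [p] that breaks the
    hypothesis.  This trades the double limit in the Cauchy condition for limits
    along a single index, the form in which property [UC] speaks. *)
Lemma cauchy_tail_selection (R : realType) (X : metricType R) (u : nat -> X) :
  (forall p : nat -> nat, (forall k, k <= p k)%N ->
     mdist (u k) (u (p k)) @[k --> \oo] --> (0 : R)) ->
  cauchy (u @ \oo).
Proof.
move=> u_merge; apply/cauchy_exP => e e_gt0; apply: contrapT => u_sparse.
have /choice[p far_p] k : exists n, (k <= n)%N /\ e <= mdist (u k) (u n).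
  apply: contrapT => near_k; apply: u_sparse; exists (u k).
  exists k => // n /= le_kn; rewrite ballEmdist/= ltNge.
  by apply/negP => far; apply: near_k; exists n.
have /cvgrPdist_lt/(_ e e_gt0)[N _ /(_ N (leqnn N))/=] :=
  u_merge p (fun k => (far_p k).1).
by rewrite sub0r normrN ger0_norm ?mdist_ge0// ltNge (far_p N).2.
Qed.

Lemma cvg_mdist_tail_selection (R : realType) (X : metricType R) (A B : set X)
    (x y : nat -> X) (p : nat -> nat) :
  (forall n, A (x n)) -> (forall n, B (y n)) -> (forall k, k <= p k)%N ->
  ereal_sup [set (mdist (x n) (y m))%:E |
              n in [set n | (k <= n)%N] & m in [set m | (k <= m)%N]]
    @[k --> \oo] --> set_dist A B ->
  (mdist (x (p k)) (y k))%:E @[k --> \oo] --> set_dist A B.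
Proof.
move=> Ax By le_p sup_cvg.
apply: (squeeze_cvge _ (cvg_cst _) sup_cvg).
apply: nearW => k; apply/andP; split.
  by apply: ereal_inf_lbound; exists (x (p k)) => //; exists (y k).
by apply: ereal_sup_ubound; exists (p k); [exact: le_p | exists k => /=].
Qed.

Theorem theorem3 (R : realType) (X : metricType R) (A B : set X)
    (A_complete : complete_set A) (AB_UC : property_UC A B) :
  property_CD A B.
Proof.
move=> x y Ax By sup_cvg; apply: A_complete => //.
apply: cauchy_tail_selection => p le_p.
apply: (AB_UC _ _ y) => //.
- exact: (cvg_mdist_tail_selection (p := id) Ax By _ sup_cvg).
- exact: (cvg_mdist_tail_selection Ax By le_p sup_cvg).
Qed.
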